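(* Let $q$ be real with $|q|<1$. (i) For all integers $m\ge1$, $$\sum_{j=0}^{m}(-1)^jq^{\binom j2}\begin{bmatrix}m\\ m-j\end{bmatrix}_q\begin{bmatrix}2m-j\\ m\end{bmatrix}_q\frac1{1-q^{m-j+1}}=0,\qquad \sum_{k=0}^m(-1)^kq^{\binom k2}\begin{bmatrix}2m\\ m-k\end{bmatrix}_q\frac{1-q^{2k+1}}{1-q^{m+k+1}}=0 .$$ (ii) For $x\in[-1,1]$, $$(q)_\infty\prod_{j=1}^\infty l(x|q^j)=\sum_{j\ge0}(-1)^jq^{\binom{j+1}2}U_{2j}(x),$$ $$\frac1{(q)_\infty\prod_{j=1}^\infty l(x|q^j)}=\sum_{j\ge0}\frac{(1-q)q^j}{(q)_j^2(1-q^{j+1})}h_{2j}(x|q).$$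
   Context: $(a)_n=(a|q)_n=\prod_{j=0}^{n-1}(1-aq^j)$, $(a)_\infty=\prod_{j\ge0}(1-aq^j)$, and $\begin{bmatrix}n\\k\end{bmatrix}_q=\frac{(q)_n}{(q)_k(q)_{n-k}}$ for $0\le k\le n$ ($0$ otherwise). $l(x|a)=(1+a)^2-4x^2a$. $U_n$ are the Chebyshev polynomials of the second kind: $U_0=1$, $U_1(x)=2x$, $2xU_n=U_{n+1}+U_{n-1}$. $h_n(x|q)$ are the continuous $q$-Hermite polynomials: $h_0=1$, $h_1(x|q)=2x$, $h_{n}(x|q)=2xh_{n-1}(x|q)-(1-q^{n-1})h_{n-2}(x|q)$. *)

(* Defs.v *)
From mathcomp Require Import all_boot all_order all_algebra.
From mathcomp Require Import all_classical all_reals all_analysis.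

Set Implicit Arguments.
Unset Strict Implicit.
Unset Printing Implicit Defensive.

Import Order.TTheory GRing.Theory Num.Theory.
Import numFieldNormedType.Exports.

Local Open Scope classical_set_scope.
Local Open Scope ring_scope.

(* (a|q)_n *)
Definition qpoch (R : realType) (a q : R) (n : nat) : R :=
  \prod_(0 <= j < n) (1 - a * q ^+ j).

(* (a|q)_oo; [limn] is a total operator, so convergence of [qpoch a q] has to
   be asserted separately. *)
Definition qpoch_inf (R : realType) (a q : R) : R := limn (qpoch a q).

Definition qbinom (R : realType) (q : R) (n k : nat) : R :=
  if (k <= n)%N then qpoch q q n / (qpoch q q k * qpoch q q (n - k)) else 0.

(* l(x|a) *)
Definition lfac (R : realType) (x a : R) : R := (1 + a) ^+ 2 - 4 * x ^+ 2 * a.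

(* \prod_(j = 1)^n l(x|q^j) and its limit, with the same caveat on [limn]. *)
Definition lprod (R : realType) (q x : R) (n : nat) : R :=
  \prod_(1 <= j < n.+1) lfac x (q ^+ j).

Definition lprod_inf (R : realType) (q x : R) : R := limn (lprod q x).

Fixpoint chebyU (R : realType) (n : nat) (x : R) : R :=
  match n with
  | 0 => 1
  | n1.+1 => match n1 with
             | 0 => 2 * x
             | n2.+1 => 2 * x * chebyU n1 x - chebyU n2 x
             end
  end.

Fixpoint qhermite (R : realType) (n : nat) (x q : R) : R :=
  match n with
  | 0 => 1
  | n1.+1 => match n1 with
             | 0 => 2 * x
             | n2.+1 =>
                 2 * x * qhermite n1 x q - (1 - q ^+ n1) * qhermite n2 x q
             end
  end.

(* Main.v *)
(** Both sums in (i) telescope: their partial sums are hypergeometric terms.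
    For the first expansion in (ii), the partial product of the [l(x|q^j)] is
    [\sum_(k <= n) (-1)^k q^(k(k+1)/2) [2n+1 choose n-k]_q U_(2k)(x)] (the finite
    Jacobi triple product), since multiplication by [l(x|a)] acts on the [U_(2k)]
    as a tridiagonal matrix; dominated convergence gives the limit. For the second, set
    [G(t) = \sum_j t^j h_(2j)(x|q) / ((q)_j (t)_(j+1))]. The three-term recurrence of
    the [h_n] gives [(1-t)^2 l(x|t) G(t) = (1-t^2)(1-t^2 q) G(tq)]; iterating from
    [t = q] and using [G(q^n) --> 1] yields
    [(1-q) (q)_oo \prod_j l(x|q^j) G(q) = 1]. *)

Require Import Defs.
From mathcomp Require Import all_boot all_order all_algebra.
From mathcomp Require Import all_classical all_reals all_analysis.
From mathcomp Require Import ring lra zify.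
Set Implicit Arguments.
Unset Strict Implicit.
Unset Printing Implicit Defensive.
Import Order.TTheory GRing.Theory Num.Theory.
Import numFieldNormedType.Exports.
Local Open Scope classical_set_scope.
Local Open Scope ring_scope.

(** * Finite [q]-factorials and the telescoping sums of (i) *)

Lemma qpochS (R : realType) (a q : R) n :
  qpoch a q n.+1 = qpoch a q n * (1 - a * q ^+ n).
Proof. by rewrite /qpoch big_nat_recr. Qed.

Lemma qpoch0 (R : realType) (a q : R) : qpoch a q 0 = 1.
Proof. by rewrite /qpoch big_geq. Qed.

Lemma qfactS (R : realType) (q : R) n :
  qpoch q q n.+1 = qpoch q q n * (1 - q ^+ n.+1).
Proof. by rewrite qpochS -exprS. Qed.

Lemma subr1_neq0 (R : realType) (t : R) (ht : `|t| < 1) : 1 - t != 0.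
Proof.
rewrite subr_eq0; apply/eqP => e.
by move: ht; rewrite -e normr1 ltxx.
Qed.

Lemma subr1X_neq0 (R : realType) (q : R) (hq : `|q| < 1) n : 1 - q ^+ n.+1 != 0.
Proof. by apply: subr1_neq0; rewrite normrX exprn_ilt1. Qed.

Lemma qfact_neq0 (R : realType) (q : R) (hq : `|q| < 1) n : qpoch q q n != 0.
Proof.
elim: n => [|n IH]; first by rewrite qpoch0 oner_neq0.
by rewrite qfactS mulf_neq0 // subr1X_neq0.
Qed.

(* The sum is a terminating [2phi1(q^-m, q^(m+1); q^2; q, q)], whose parameters
   satisfy the condition [c = abq] for indefinite summability. *)
Lemma first_sum_partial (R : realType) (q : R) (hq : `|q| < 1) n d :
  let m := (n + d.+1)%N in
  \sum_(0 <= j < n.+1)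
     (-1) ^+ j * q ^+ 'C(j, 2) * qbinom q m (m - j)
       * qbinom q (2 * m - j) m * (1 / (1 - q ^+ (m - j + 1)))
  = (-1) ^+ n * q ^+ 'C(n.+1, 2) * qpoch q q (2 * m - n) /
    (qpoch q q n * qpoch q q d * qpoch q q d.+1 * (1 - q ^+ m) * (1 - q ^+ m.+1)).
Proof.
have nz k : 1 - q ^+ k.+1 != 0 by exact: subr1X_neq0.
have nf k : qpoch q q k != 0 by exact: qfact_neq0.
elim: n d => [|n IH] d /=.
  rewrite big_nat1 /qbinom subn0 leqnn add0n subnn qpoch0 expr0 mul1r bin_small //.
  have -> : (d.+1 <= 2 * d.+1 - 0)%N by lia.
  have -> : (2 * d.+1 - 0 - d.+1 = d.+1)%N by lia.
  rewrite addn1 !expr0 !qfactS; field.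
  by rewrite nf !nz.
rewrite big_nat_recr //=.
(* [m] stays fixed as [n] grows, so the hypothesis is used at [d.+1]. Written through [n] and [d],
   the indices lose their subtractions; once common factorials are split off, a rational identity in
   [q], [q^n], [q^d] remains. *)
have -> : (n.+1 + d.+1 = n + d.+2)%N by lia.
rewrite IH.
rewrite /qbinom.
have -> : (n + d.+2 - n.+1 <= n + d.+2)%N by lia.
have -> : (n + d.+2 <= 2 * (n + d.+2) - n.+1)%N by lia.
have -> : (n + d.+2 - (n + d.+2 - n.+1) = n.+1)%N by lia.
have -> : (n + d.+2 - n.+1 = d.+1)%N by lia.
have -> : (2 * (n + d.+2) - n = (n + d + d).+4)%N by lia.
have -> : (2 * (n + d.+2) - n.+1 = (n + d + d).+3)%N by lia.
have -> : ((n + d + d).+3 - (n + d.+2) = d.+1)%N by lia.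
have -> : (n + d.+2 = (n + d).+2)%N by lia.
have nfm := nf (n + d).+2; have nfn := nf n; have nfd := nf d.
have nz1 := nz (n + d)%N.+1; have nz2 := nz (n + d)%N.+2.
have nz3 := nz n; have nz4 := nz d; have nz5 := nz d.+1.
rewrite [in 'C(n.+2, 2)]binS bin1 addn1 (qfactS q d.+1) (qfactS q d) (qfactS q n) (qfactS q (n + d + d).+3).
move: nz1 nz2 nz3 nz4 nz5.
rewrite !(exprS, exprD).
move: (qpoch _ _ _) nfm => M nfm; move: (qpoch q q n) nfn => N nfn.
move: (qpoch q q d) nfd => D nfd; move: (qpoch q q _) => P.
move: (q ^+ n) (q ^+ d) (q ^+ _) ((-1) ^+ n) => a b c s *.
by field; do ?[apply/andP; split].
Qed.

(* A limiting case of the indefinite very-well-poised [6phi5] sum with [a = q]. *)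
Lemma second_sum_partial (R : realType) (q : R) (hq : `|q| < 1) n d :
  let m := (n + d.+1)%N in
  \sum_(0 <= k < n.+1)
        (-1) ^+ k * q ^+ 'C(k, 2) * qbinom q (2 * m) (m - k)
          * ((1 - q ^+ (2 * k + 1)) / (1 - q ^+ (m + k + 1)))
  = (-1) ^+ n * q ^+ 'C(n.+1, 2) * qpoch q q (2 * m) * (1 - q ^+ n.+1) /
    (qpoch q q d * qpoch q q (m + n).+1 * (1 - q ^+ m)).
Proof.
have nz k : 1 - q ^+ k.+1 != 0 by exact: subr1X_neq0.
have nf k : qpoch q q k != 0 by exact: qfact_neq0.
elim: n d => [|n IH] d /=.
  rewrite big_nat1 /qbinom subn0 add0n.
  have -> : (d.+1 <= 2 * d.+1)%N by lia.
  have -> : (2 * d.+1 - d.+1 = d.+1)%N by lia.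
  rewrite muln0 add0n addn0 addn1 bin_small // !expr0 expr1 !qfactS; field.
  by rewrite nf !nz.
rewrite big_nat_recr //=.
have -> : (n.+1 + d.+1 = n + d.+2)%N by lia.
rewrite IH /qbinom.
have -> : (n + d.+2 - n.+1 <= 2 * (n + d.+2))%N by lia.
have -> : (n + d.+2 - n.+1 = d.+1)%N by lia.
have -> : (2 * (n + d.+2) - d.+1 = (n + n + d).+3)%N by lia.
have -> : ((n + d.+2 + n).+1 = (n + n + d).+3)%N by lia.
have -> : ((n + d.+2 + n.+1).+1 = (n + n + d).+4)%N by lia.
have -> : ((n + d.+2 + n.+1 + 1) = (n + n + d).+4)%N by lia.
have -> : (2 * n.+1 + 1 = (n + n).+3)%N by lia.
have -> : (n + d.+2 = (n + d).+2)%N by lia.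
have nfm := nf (n + n + d).+3; have nfd := nf d.
have nz1 := nz (n + d)%N.+1; have nz2 := nz (n + n + d)%N.+3.
have nz4 := nz d.
rewrite [in 'C(n.+2, 2)]binS bin1 (qfactS q d) (qfactS q (n + n + d).+3).
move: nz1 nz2 nz4.
rewrite !(exprS, exprD).
move: (qpoch _ _ (2 * _)) => M; move: (qpoch q q _.+3) nfm => N nfn.
move: (qpoch q q d) nfd => D nfd.
move: (q ^+ n) (q ^+ d) (q ^+ _) ((-1) ^+ n) => a b c s *.
by field; do ?[apply/andP; split].
Qed.

(** The closed form of the partial sums presupposes [n < m]. At [d = 0] it covers all terms but the
    last, and the last term is its negative. *)
Lemma first_sum_eq0 (R : realType) (q : R) (hq : `|q| < 1) m : (1 <= m)%N ->
  \sum_(0 <= j < m.+1)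
     (-1) ^+ j * q ^+ 'C(j, 2) * qbinom q m (m - j)
       * qbinom q (2 * m - j) m * (1 / (1 - q ^+ (m - j + 1))) = 0.
Proof.
have nz k : 1 - q ^+ k.+1 != 0 by exact: subr1X_neq0.
have nf k : qpoch q q k != 0 by exact: qfact_neq0.
case: m => // n _; rewrite big_nat_recr //=.
have := first_sum_partial hq n 0; rewrite /= addn1 => ->.
rewrite /qbinom subnn leq0n subn0.
have -> : (2 * n.+1 - n = n.+2)%N by lia.
have -> : (2 * n.+1 - n.+1 = n.+1)%N by lia.
rewrite leqnn subnn qpoch0 add0n expr1 !qfactS qpoch0.
have := nz 0%N; rewrite expr1 => nz0.
rewrite (exprS (-1)); field.
by rewrite nz0 nf !nz.
Qed.

Lemma second_sum_eq0 (R : realType) (q : R) (hq : `|q| < 1) m : (1 <= m)%N ->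
  \sum_(0 <= k < m.+1)
     (-1) ^+ k * q ^+ 'C(k, 2) * qbinom q (2 * m) (m - k)
       * ((1 - q ^+ (2 * k + 1)) / (1 - q ^+ (m + k + 1))) = 0.
Proof.
have nz k : 1 - q ^+ k.+1 != 0 by exact: subr1X_neq0.
have nf k : qpoch q q k != 0 by exact: qfact_neq0.
case: m => // n _; rewrite big_nat_recr //=.
have := second_sum_partial hq n 0; rewrite /= addn1 => ->.
rewrite /qbinom subnn leq0n subn0.
have -> : ((n.+1 + n).+1 = 2 * n.+1)%N by lia.
have -> : (n.+1 + n.+1 + 1 = 2 * n.+1 + 1)%N by lia.
rewrite qpoch0 addn1 (exprS (-1)); field.
by rewrite nf !nz.
Qed.

(** * Bounds and convergence of infinite [q]-products *)

(** Weierstrass's product inequality. *)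
Lemma prod_sub1_ge (R : realType) (a : nat -> R) m n :
  (forall i, 0 <= a i <= 1) ->
  1 - \sum_(m <= i < n) a i <= \prod_(m <= i < n) (1 - a i) <= 1.
Proof.
move=> ha; elim: n => [|n IH]; first by rewrite !big_geq // subr0 lexx.
have [mn|nm] := leqP m n; last by rewrite !big_geq // subr0 lexx.
rewrite !big_nat_recr //=; move: IH (ha n) => /andP[] + + /andP[].
have : 0 <= \prod_(m <= i < n) (1 - a i).
  by apply: prodr_ge0 => i _; rewrite subr_ge0; case/andP: (ha i).
move: (\prod_(_ <= _ < _) _) (\sum_(_ <= _ < _) _) => P S *; apply/andP; split; nra.
Qed.

Lemma exprn_small (R : realType) (p e : R) : 0 <= p < 1 -> 0 < e ->
  exists m, forall n, (m <= n)%N -> p ^+ n <= e.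
Proof.
case/andP=> p0 p1 e0.
have hp : `|p| < 1 by rewrite ger0_norm.
have /cvgr0Pnorm_lt /(_ e e0)[N _ hN] := cvg_expr hp.
exists N => n /hN /=; rewrite normrX (ger0_norm p0); exact: ltW.
Qed.

Lemma qfact_lower_bound (R : realType) (p : R) : 0 <= p < 1 ->
  exists2 d : R, 0 < d <= 1 & forall n, d <= qpoch p p n.
Proof.
move=> hp; case/andP: (hp) => p0 p1.
have pX i : 0 <= p ^+ i.+1 <= 1 by rewrite exprn_ge0 // exprn_ile1 // ltW.
have sumE m n : (m <= n)%N ->
    (1 - p) * \sum_(m <= i < n) p ^+ i.+1 = p ^+ m.+1 - p ^+ n.+1.
  elim: n => [|n IH]; first by rewrite leqn0 => /eqP->; rewrite big_geq // mulr0 subrr.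
  rewrite leq_eqVlt => /predU1P[->|mn]; first by rewrite big_geq // mulr0 subrr.
  by rewrite big_nat_recr //= mulrDr IH // !exprS; ring.
(* By [sumE], this threshold keeps the sum of [p^(i+1)] over [i >= m] at most 1/2, so the tail of
   the product stays above 1/2 and only the head [qpoch p p m] matters. *)
have [|m hm] := @exprn_small _ p ((1 - p) / 2) hp; first by lra.
have qE n : qpoch p p n = \prod_(0 <= i < n) (1 - p ^+ i.+1).
  by apply: eq_bigr => i _; rewrite exprS.
have q01 n : 0 < qpoch p p n <= 1.
  rewrite qE; have /andP[_ ->] := prod_sub1_ge 0 n pX; rewrite andbT.
  by apply: prodr_gt0 => i _; rewrite subr_gt0 exprn_ilt1.
exists (qpoch p p m / 2).
  by have := q01 m; lra.
move=> n; have [nm|mn] := leqP n m.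
  have -> : qpoch p p m = qpoch p p n * \prod_(n <= i < m) (1 - p ^+ i.+1).
    by rewrite !qE -big_cat_nat.
  have := q01 n; have /andP[_] := prod_sub1_ge n m pX.
  move: (qpoch _ _ _) (\prod_(_ <= _ < _) _) => P S; nra.
have -> : qpoch p p n = qpoch p p m * \prod_(m <= i < n) (1 - p ^+ i.+1).
  by rewrite !qE -big_cat_nat // ltnW.
apply: ler_wpM2l; first by have := q01 m; lra.
have /andP[+ _] := prod_sub1_ge m n pX; apply: le_trans.
have := sumE _ _ (ltnW mn); have := pX n; have := hm m.+1 (leqnSn m).
move: (\sum_(_ <= _ < _) _) (p ^+ _) (p ^+ _) => S a b; nra.
Qed.

(** Factor by factor, with [w = |q|^(i+1)]: [|1 - t q^i|] lies between [1 - w] and [1 + w], and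
    [(1 + w)(1 - w) <= 1]. The bounds are uniform in [t], which the limit [t --> 0] requires
    later. *)
Lemma qpoch_norm_bounds (R : realType) (q t d : R) : `|q| < 1 -> `|t| <= `|q| ->
  0 < d -> (forall n, d <= qpoch `|q| `|q| n) ->
  forall n, d <= `|qpoch t q n| <= d^-1.
Proof.
move=> hq ht d0 hd n.
have a01 i : (0 <= `|t * q ^+ i|) && (`|t * q ^+ i| <= `|q| ^+ i.+1 < 1).
  rewrite normr_ge0 exprn_ilt1 // andbT normrM normrX exprS.
  by rewrite ler_wpM2r // exprn_ge0.
have qE : qpoch `|q| `|q| n = \prod_(0 <= i < n) (1 - `|q| ^+ i.+1).
  by apply: eq_bigr => i _; rewrite exprS.
have lo : qpoch `|q| `|q| n <= `|qpoch t q n|.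
  rewrite qE /qpoch normr_prod; apply: ler_prod => i _.
  have /andP[_ /andP[h1 h2]] := a01 i; rewrite subr_ge0 ltW //=.
  have := ler_norm (t * q ^+ i); have := ler_norm (1 - t * q ^+ i); lra.
have up : `|qpoch t q n| * qpoch `|q| `|q| n <= 1.
  rewrite qE /qpoch normr_prod -big_split /=; apply: prodr_ile1 => i _.
  have /andP[h0 /andP[h1 h2]] := a01 i.
  have h3 := ler_normB 1 (t * q ^+ i); rewrite normr1 in h3.
  move: (normr_ge0 (1 - t * q ^+ i)) h0 h1 h2 h3.
  move: (`|q| ^+ _) (`|t * _|) (`|_ - _|) => w v u *; apply/andP; split; nra.
rewrite (le_trans (hd n) lo) /=.
have : d * `|qpoch t q n| <= 1.
  by apply: le_trans up; rewrite mulrC ler_wpM2l.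
by rewrite -ler_pdivlMl // mulr1.
Qed.

(** The increments are [- q^(n+1)] times bounded products, hence dominated by a geometric series. *)
Lemma qpoch_cvg (R : realType) (q : R) : `|q| < 1 -> cvgn (qpoch q q).
Proof.
move=> hq.
have hp : 0 <= `|q| < 1 by rewrite normr_ge0.
have [d /andP[d0 _] hd] := qfact_lower_bound hp.
have bd := qpoch_norm_bounds hq (lexx _) d0 hd.
have H : cvgn (series (telescope (qpoch q q))).
  apply: normed_cvg.
  apply: (@series_le_cvg _ _ (geometric d^-1 `|q|)) => [n|n|n|] //=.
  - by rewrite mulr_ge0 ?exprn_ge0 // invr_ge0 ltW.
  - rewrite /telescope /= qfactS mulrBr mulr1 addrAC subrr add0r normrN normrM normrX exprSr.
    have /andP[_ b] := bd n.
    apply: ler_pM => //; rewrite ?mulr_ge0 ?exprn_ge0 //.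
    by rewrite ler_piMr ?exprn_ge0 // ltW.
  - by apply: is_cvg_geometric_series; rewrite normr_id.
rewrite telescopeK in H.
have -> : qpoch q q = (fun n => (qpoch q q n - qpoch q q 0) + qpoch q q 0).
  by apply/funext => n; rewrite subrK.
by apply: is_cvgD => //; exact: is_cvg_cst.
Qed.

Lemma qpoch_inf_neq0 (R : realType) (q : R) : `|q| < 1 -> qpoch_inf q q != 0.
Proof.
move=> hq.
have hp : 0 <= `|q| < 1 by rewrite normr_ge0.
have [d /andP[d0 _] hd] := qfact_lower_bound hp.
rewrite -normr_gt0; apply: (lt_le_trans d0).
apply: (cvgr_to_ge (cvg_norm (qpoch_cvg hq))).
by apply: nearW => n; have /andP[] := qpoch_norm_bounds hq (lexx _) d0 hd n.
Qed.

(** * Dominated convergence for series *)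

(** The truncation error is controlled by the majorant alone, hence uniformly in any parameter of
    [u]. *)
Lemma series_tail_le (R : realType) (u M : nat -> R) (s : R) :
  (forall k, `|u k| <= M k) -> cvgn (series M) -> series u @ \oo --> s ->
  forall N, `|s - series u N| <= limn (series M) - series M N.
Proof.
move=> uM cM us N.
have c1 : (series u n - series u N) @[n --> \oo] --> s - series u N.
  by apply: cvgB => //; exact: cvg_cst.
apply: (cvgr_to_le (cvg_norm c1)); near=> n.
have Nn : (N <= n)%N by near: n; exact: nbhs_infty_ge.
rewrite !sub_series Nn.
apply: (@le_trans _ _ (\sum_(N <= k < n) M k)).
  by apply: le_trans (ler_norm_sum _ _ _) (ler_sum _ _) => i _.
have := sub_series M N n; rewrite Nn => <-.
rewrite lerD2r; apply: nondecreasing_cvgn_le => //.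
by apply/nondecreasing_seqP => k; rewrite /series /= big_nat_recr //= lerDl (le_trans _ (uM k)).
Unshelve. all: by end_near. Qed.

Lemma series_dominated_cvg (R : realType) (u M : nat -> R) :
  (forall k, `|u k| <= M k) -> cvgn (series M) -> cvgn (series u).
Proof.
move=> uM; have M0 k : 0 <= M k by exact: le_trans (uM k).
by move=> cM; apply: normed_cvg; apply: series_le_cvg cM => //= k.
Qed.

Lemma tannery (R : realType) (f : nat -> nat -> R) (g M s : nat -> R) :
  (forall n k, `|f n k| <= M k) -> cvgn (series M) ->
  (forall k, f n k @[n --> \oo] --> g k) ->
  (forall n, series (f n) @ \oo --> s n) ->
  s @ \oo --> limn (series g).
Proof.
move=> fM cM fg fs.
have gM k : `|g k| <= M k.
  apply: (cvgr_to_le (cvg_norm (fg k))); exact: nearW.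
have cg : cvgn (series g) by exact: series_dominated_cvg cM.
apply/cvgrPdist_lt => e e0.
have e3 : 0 < e / 3 by lra.
(* The cut-off [N] depends on [M] only, so it is fixed before [n]; the finite sums up to [N] then
   converge term by term. *)
have /cvgrPdist_lt /(_ _ e3)[N _ hN] := cM.
have {hN} hN := hN N (leqnn N).
have cN : series (f n) N @[n --> \oo] --> series g N.
  rewrite /series /=; elim: (N) => [|m IH].
    rewrite big_geq //; under eq_fun do rewrite big_geq //; exact: cvg_cst.
  rewrite big_nat_recr //=; under eq_fun do rewrite big_nat_recr //=.
  by apply: cvgD.
move/cvgrPdist_lt: cN => /(_ _ e3); apply: filterS => n hn.
have t1 := series_tail_le gM cM cg N.
have t2 := series_tail_le (fM n) cM (fs n) N.
have hN' : limn (series M) - series M N < e / 3.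
  by apply: le_lt_trans hN; exact: ler_norm.
have -> : limn (series g) - s n = (limn (series g) - series g N)
  + (series g N - series (f n) N) - (s n - series (f n) N) by ring.
apply: le_lt_trans (ler_normB _ _) _.
apply: le_lt_trans (lerD (ler_normD _ _) (lexx _)) _.
by move: t1 t2 hn hN'; lra.
Qed.

(** * Tridiagonal multiplication and the finite triple product *)

(** Coefficients transform by the transpose of the tridiagonal matrix acting on [u]; truncation at
    [n] leaves the two boundary terms. These vanish in the Chebyshev expansion and tend to 0 in the
    functional equation of [G]. *)
Lemma tridiagonal_sum (R : realType) (L b : R) (alpha gamma u c e : nat -> R) :
  L * u 0 = alpha 0 * u 0 + b * u 1 ->
  (forall k, L * u k.+1 = alpha k.+1 * u k.+1 + b * u k.+2 + gamma k * u k) ->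
  e 0 = alpha 0 * c 0 + gamma 0 * c 1 ->
  (forall k, e k.+1 = alpha k.+1 * c k.+1 + b * c k + gamma k.+1 * c k.+2) ->
  forall n, L * \sum_(0 <= k < n.+1) c k * u k
    = \sum_(0 <= k < n.+1) e k * u k + b * c n * u n.+1 - gamma n * c n.+1 * u n.
Proof.
move=> L0 LS e0 eS; elim=> [|n IH]; first by rewrite !big_nat1 mulrCA L0 e0; ring.
by rewrite big_nat_recr //= mulrDr IH mulrCA LS [in RHS]big_nat_recr //= eS; ring.
Qed.

(** The test [k <= n] is needed since truncated subtraction would make the binomial 1, not 0, for
    [k > n]. *)
Definition triple_coef (R : realType) (q : R) (n k : nat) : R :=
  (-1) ^+ k * q ^+ 'C(k + 1, 2) *
  (if (k <= n)%N then qbinom q (2 * n + 1) (n - k) else 0).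

(** Indices enter through equations, so that each use can pick additive normal forms suited to
    [field]. *)
Lemma triple_coefE (R : realType) (q : R) n k d a b :
  n = (k + d)%N -> a = (2 * n + 1)%N -> b = (2 * k + d + 1)%N ->
  triple_coef q n k = (-1) ^+ k * q ^+ 'C(k + 1, 2) *
   (qpoch q q a / (qpoch q q d * qpoch q q b)).
Proof.
move=> -> -> ->; rewrite /triple_coef leq_addr /qbinom.
have -> : (k + d - k <= 2 * (k + d) + 1)%N by lia.
have -> : (k + d - k = d)%N by lia.
by have -> : (2 * (k + d) + 1 - d = 2 * k + d + 1)%N by lia.
Qed.

Lemma triple_coef_gt (R : realType) (q : R) n k : (n < k)%N -> triple_coef q n k = 0.
Proof. by rewrite /triple_coef ltnNge => /negbTE->; rewrite mulr0. Qed.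

(** This is the general recurrence at [k = -1]: the symmetry of the binomials makes the coefficient
    of index -1 the negative of that of index 0, whence the extra [q^(n+1)] on the diagonal. *)
Lemma triple_coefS0 (R : realType) (q : R) : `|q| < 1 -> forall n,
  triple_coef q n.+1 0 = (1 + q ^+ n.+1 ^+ 2 + q ^+ n.+1) * triple_coef q n 0
    - q ^+ n.+1 * triple_coef q n 1.
Proof.
move=> hq.
have nz k : 1 - q ^+ k.+1 != 0 by exact: subr1X_neq0.
have nf k : qpoch q q k != 0 by exact: qfact_neq0.
case=> [|n].
  rewrite (triple_coef_gt q (ltnSn 0)).
  rewrite (@triple_coefE _ q 1 0 1 3 2) // (@triple_coefE _ q 0 0 0 1 1) //.
  rewrite !qfactS qpoch0.
  have := nz 0; have := nz 1; have := nz 2; rewrite !exprS !expr0 !mulr1 => *.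
  by field; do ?[apply/andP; split].
rewrite (@triple_coefE _ q n.+2 0 n.+2 (n + n).+4.+1 n.+3); try lia.
rewrite (@triple_coefE _ q n.+1 0 n.+1 (n + n).+3 n.+2); try lia.
rewrite (@triple_coefE _ q n.+1 1 n (n + n).+3 n.+3); try lia.
rewrite (_ : 'C(0 + 1, 2) = 0)%N // (_ : 'C(1 + 1, 2) = 1)%N //.
have := nz n; have := nz n.+1; have := nz n.+2.
have := nf n; have := nf (n + n)%N.+3.
rewrite (qfactS q n.+2) (qfactS q n.+1) (qfactS q n) (qfactS q (n + n).+4) (qfactS q (n + n).+3).
rewrite !(exprS, exprD) !expr0 !mulr1.
move: (qpoch q q n) (qpoch q q _) (q ^+ n) => N M a *.
by field; do ?[apply/andP; split].
Qed.

(** Two applications of the [q]-Pascal rule lead from row [2n+1] of the [q]-binomials to row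
    [2n+3]. *)
Lemma triple_coefSS (R : realType) (q : R) : `|q| < 1 -> forall n k,
  triple_coef q n.+1 k.+1 = (1 + q ^+ n.+1 ^+ 2) * triple_coef q n k.+1
    - q ^+ n.+1 * triple_coef q n k - q ^+ n.+1 * triple_coef q n k.+2.
Proof.
move=> hq n k.
have nz j : 1 - q ^+ j.+1 != 0 by exact: subr1X_neq0.
have nf j : qpoch q q j != 0 by exact: qfact_neq0.
have [nk|kn] := ltnP n k.
  by rewrite !triple_coef_gt ?mulr0 ?subr0 //; lia.
have binE : 'C(k.+1 + 1, 2) = ('C(k + 1, 2) + k.+1)%N by rewrite addn1 binS bin1 addn1.
have binE2 : 'C(k.+2 + 1, 2) = ('C(k + 1, 2) + k.+1 + k.+2)%N.
  by rewrite addn1 binS bin1 -addn1 binE.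
have [d ->] : exists d, n = (k + d)%N by exists (n - k)%N; lia.
(* For [d = 0] and [d = 1] some coefficients on the right fall outside the support and have no
   closed form by factorials. *)
case: d => [|[|d]].
- rewrite (@triple_coef_gt _ q (k + 0) k.+1) ?(@triple_coef_gt _ q _ k.+2); try lia.
  rewrite (@triple_coefE _ q _ k.+1 0 (k + k).+3 (k + k).+3); try lia.
  rewrite (@triple_coefE _ q _ k 0 (k + k).+1 (k + k).+1); try lia.
  rewrite binE qpoch0 addn0.
  have := nf (k + k)%N.+3; have := nf (k + k)%N.+1.
  move: (qpoch _ _ _) (qpoch _ _ _) => M N *.
  rewrite (exprS (-1)) exprD; field.
  by do ?[apply/andP; split].
- rewrite (@triple_coef_gt _ q _ k.+2); try lia.
  rewrite (@triple_coefE _ q _ k.+1 1 (k + k).+4.+1 (k + k).+4); try lia.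
  rewrite (@triple_coefE _ q _ k.+1 0 (k + k).+3 (k + k).+3); try lia.
  rewrite (@triple_coefE _ q _ k 1 (k + k).+3 (k + k).+2); try lia.
  rewrite binE addn1.
  have := nz 0%N; have := nz (k + k)%N.+2; have := nz (k + k)%N.+3; have := nf (k + k)%N.+2.
  rewrite (qfactS q 0) qpoch0 (qfactS q (k + k).+4) (qfactS q (k + k).+3) (qfactS q (k + k).+2).
  rewrite !(exprS, exprD) !expr0 !mulr1.
  move: (qpoch _ _ _) (q ^+ k) (q ^+ _) => M a c *.
  by field; do ?[apply/andP; split].
- rewrite (@triple_coefE _ q _ k.+1 d.+2 (k + k + d + d).+4.+3 (k + k + d).+4.+1); try lia.
  rewrite (@triple_coefE _ q _ k.+1 d.+1 (k + k + d + d).+4.+1 (k + k + d).+4); try lia.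
  rewrite (@triple_coefE _ q _ k d.+2 (k + k + d + d).+4.+1 (k + k + d).+3); try lia.
  rewrite (@triple_coefE _ q _ k.+2 d (k + k + d + d).+4.+1 (k + k + d).+4.+1); try lia.
  rewrite binE binE2.
  have := nz d; have := nz d.+1; have := nf d; have := nf (k + k + d)%N.+3.
  have := nz (k + k + d)%N.+3; have := nz (k + k + d)%N.+4.
  rewrite (qfactS q (k + k + d + d).+4.+2) (qfactS q (k + k + d + d).+4.+1).
  rewrite (qfactS q d.+1) (qfactS q d) (qfactS q (k + k + d).+4) (qfactS q (k + k + d).+3).
  rewrite !(exprS, exprD).
  move: (qpoch _ _ _) (qpoch _ _ _) (qpoch _ _ _) => M N P.
  move: (q ^+ k) (q ^+ d) (q ^+ _) => a b c *.
  by field; do ?[apply/andP; split].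
Qed.

Lemma chebyUSS (R : realType) (x : R) n :
  chebyU n.+2 x = 2 * x * chebyU n.+1 x - chebyU n x.
Proof. by []. Qed.

Lemma qhermiteSS (R : realType) (q x : R) n :
  qhermite n.+2 x q = 2 * x * qhermite n.+1 x q - (1 - q ^+ n.+1) * qhermite n x q.
Proof. by []. Qed.

(** Lets the growth bound for the [h_n] serve for the [U_n] as well. *)
Lemma qhermite_q0 (R : realType) (x : R) n : qhermite n x 0 = chebyU n x.
Proof.
elim/ltn_ind: n => -[|[|n]] IH //.
by rewrite qhermiteSS chebyUSS !IH // expr0n subr0 mul1r.
Qed.

Lemma lprodS (R : realType) (q x : R) n :
  lprod q x n.+1 = lprod q x n * lfac x (q ^+ n.+1).
Proof. by rewrite /lprod big_nat_recr. Qed.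

Lemma lprod_chebyU (R : realType) (q x : R) : `|q| < 1 -> forall n,
  lprod q x n = \sum_(0 <= k < n.+1) triple_coef q n k * chebyU (2 * k) x.
Proof.
move=> hq; elim=> [|n IH].
  rewrite big_nat1 /lprod big_geq // (@triple_coefE _ q 0 0 0 1 1) // muln0.
  by rewrite qpoch0 mul1r divff ?qfact_neq0 // !mulr1.
set a := q ^+ n.+1.
pose u k := chebyU (2 * k) x.
(* The entry at 0 is exceptional because [U_(-2) = - U_0] folds back onto the diagonal. *)
pose al k : R := if k is 0 then 1 + a ^+ 2 + a else 1 + a ^+ 2.
have u0 : lfac x a * u 0%N = al 0%N * u 0%N + - a * u 1%N.
  by rewrite /u muln0 muln1 /al /lfac /=; ring.
have uS k : lfac x a * u k.+1 = al k.+1 * u k.+1 + - a * u k.+2 + - a * u k.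
  rewrite /u (_ : 2 * k.+2 = (2 * k).+4)%N; last by lia.
  rewrite (_ : 2 * k.+1 = (2 * k).+2)%N; last by lia.
  by rewrite /al /lfac !chebyUSS; ring.
have e0 : triple_coef q n.+1 0 = al 0%N * triple_coef q n 0 + - a * triple_coef q n 1.
  by rewrite triple_coefS0 // mulNr.
have eS k : triple_coef q n.+1 k.+1 = al k.+1 * triple_coef q n k.+1
    + - a * triple_coef q n k + - a * triple_coef q n k.+2.
  by rewrite triple_coefSS // !mulNr.
(* Summing one index past the support of [triple_coef q n] kills both boundary terms. *)
have := tridiagonal_sum (gamma := fun=> - a) u0 uS e0 eS n.+1.
rewrite (triple_coef_gt q (ltnSn n)) (triple_coef_gt q (ltnW (ltnSn n.+1))).
rewrite !mulr0 !mul0r subr0 addr0 => <-.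
rewrite lprodS IH mulrC [in RHS]big_nat_recr //=.
by rewrite (triple_coef_gt q (ltnSn n)) mul0r addr0.
Qed.

(** * Growth of the continuous [q]-Hermite polynomials on [[-1,1]] *)

(* The energy [h_n^2 - 2x h_n h_(n-1) + h_(n-1)^2] is constant when [q = 0], and
   perturbing the recurrence by [d] changes its square root by at most [`|d|]. *)
Lemma qhermite_bound (R : realType) (q x r : R) : `|q| < 1 -> -1 <= x <= 1 -> 1 < r ->
  exists2 K : R, 0 <= K & forall n, `|qhermite n x q| <= K * r ^+ n.
Proof.
move=> hq hx r1.
pose h n := qhermite n x q.
have hp : 0 <= `|q| < 1 by rewrite normr_ge0.
(* From [n0] on, the perturbation is at most [K (r-1)^2 r^m], exactly the increment of the energy
   bound [K (r-1) r^m] from [m] to [m+1]. *)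
have [|n0 hn0] := @exprn_small _ `|q| ((r - 1) ^+ 2) hp; first by rewrite exprn_gt0 // subr_gt0.
pose S := \sum_(0 <= k < n0.+2) `|h k|.
have hS k : (k <= n0.+1)%N -> `|h k| <= S.
  move=> kn; rewrite /S (bigD1_seq k) ?iota_uniq ?mem_index_iota //=.
  by rewrite lerDl sumr_ge0.
have S0 : 0 <= S by apply: le_trans (hS 0%N isT).
(* [S] bounds the initial values and [2 S] the square root of the energy at [n0]; [K] must satisfy
   [S <= K] and [2 S <= K (r-1)]. *)
pose K := S + 2 * S / (r - 1).
have SK : S <= K by rewrite /K lerDl divr_ge0 ?mulr_ge0 ?subr_ge0 // ltW.
have SK2 : 2 * S <= K * (r - 1).
  by rewrite /K [leRHS]mulrDl divfK ?subr_eq0 ?gt_eqF // lerDr mulr_ge0 // subr_ge0 ltW.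
have K0 : 0 <= K by exact: le_trans SK.
have rX n : 1 <= r ^+ n by rewrite exprn_ege1 // ltW.
pose e n := h n.+1 ^+ 2 - 2 * x * h n.+1 * h n + h n ^+ 2.
have sqle (a b : R) : 0 <= b -> a ^+ 2 <= b ^+ 2 -> `|a| <= b.
  by move=> b0 ab; rewrite -(ger0_norm b0) -ler_sqr ?nnegrE // !real_normK ?num_real.
have x2 : 0 <= 1 - x ^+ 2 by nra.
have main n : [/\ `|h (n0 + n)%N| <= K * r ^+ (n0 + n),
    `|h (n0 + n).+1| <= K * r ^+ (n0 + n).+1
    & e (n0 + n)%N <= (K * (r - 1) * r ^+ (n0 + n)) ^+ 2].
  elim: n => [|n [h0 h1 he]].
    rewrite addn0; split.
    - apply: (le_trans (hS _ (leqnSn _))).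
      by apply: (le_trans SK); rewrite ler_peMr.
    - by apply: (le_trans (hS _ _)) => //; apply: (le_trans SK); rewrite ler_peMr.
    - have b0 := hS n0 (leqnSn _); have b1 := hS n0.+1 (leqnn _).
      apply: (@le_trans _ _ ((2 * S) ^+ 2)); last first.
        rewrite ler_sqr ?nnegrE ?mulr_ge0 ?subr_ge0 ?(ltW r1) ?exprn_ge0 //; last by lra.
        apply: (le_trans SK2); rewrite ler_peMr // mulr_ge0 // subr_ge0 ltW //.
      have b2 : `|x * (h n0.+1 * h n0)| <= S ^+ 2.
        rewrite normrM; apply: (@le_trans _ _ (1 * `|h n0.+1 * h n0|)).
          by rewrite ler_wpM2r // ler_norml.
        by rewrite mul1r normrM expr2 ler_pM.
      have sq k : `|h k| <= S -> h k ^+ 2 <= S ^+ 2.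
        by move=> hk; rewrite -(real_normK (num_real (h k))) ler_sqr ?nnegrE.
      have := sq _ b0; have := sq _ b1; move: b2; rewrite ler_norml => /andP[].
      rewrite /e -!mulrA; lra.
  set m := (n0 + n)%N in h0 h1 he *.
  rewrite addnS -/m.
  pose d := q ^+ m.+1 * h m.
  have hd : `|d| <= (r - 1) ^+ 2 * (K * r ^+ m).
    rewrite normrM; apply: ler_pM => //; rewrite normrX; apply: hn0.
    by rewrite leqW // leq_addr.
  have hr : h m.+2 = 2 * x * h m.+1 - h m + d.
    by rewrite /h qhermiteSS /d /h; ring.
  set E := K * (r - 1) * r ^+ m in he.
  have E0 : 0 <= E by rewrite !mulr_ge0 ?exprn_ge0 ?subr_ge0 // ltW // (lt_trans ltr01).
  (* The energy equals [(x h_(m+1) - h_m)^2 + (1 - x^2) h_(m+1)^2]. *)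
  have hxm : `|x * h m.+1 - h m| <= E.
    apply: sqle => //; apply: le_trans he; rewrite /e.
    have := sqr_ge0 (h m.+1); move: (h m.+1) (h m) => u v *; nra.
  have he' : e m.+1 <= (E + `|d|) ^+ 2.
    have -> : e m.+1 = e m + d ^+ 2 + 2 * (d * (x * h m.+1 - h m)).
      by rewrite /e hr; ring.
    have : d * (x * h m.+1 - h m) <= `|d| * E.
      by apply: (le_trans (ler_norm _)); rewrite normrM ler_wpM2l.
    have : d ^+ 2 = `|d| ^+ 2 by rewrite real_normK ?num_real.
    by move=> ->; nra.
  have Ed : E + `|d| <= K * (r - 1) * r ^+ m.+1.
    by move: hd; rewrite /E (exprS r m); lra.
  have Ed0 : 0 <= E + `|d| by rewrite addr_ge0.
  have he2 : e m.+1 <= (K * (r - 1) * r ^+ m.+1) ^+ 2.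
    by apply: (le_trans he'); rewrite ler_sqr ?nnegrE // (le_trans Ed0).
  split=> //.
  (* The same completion of the square, now around [h_(m+2)]; adding [|x h_(m+1)| <= K r^(m+1)]
     gives exactly [K r^(m+2)]. *)
  have : `|h m.+2 - x * h m.+1| <= K * (r - 1) * r ^+ m.+1.
    apply: sqle; first exact: le_trans Ed.
    apply: le_trans he2; rewrite /e.
    have := sqr_ge0 (h m.+1); move: (h m.+1) (h m.+2) => u v *; nra.
  have : `|x * h m.+1| <= K * r ^+ m.+1.
    by rewrite normrM; apply: le_trans h1; rewrite ler_piMl // ler_norml.
  have := ler_normD (h m.+2 - x * h m.+1) (x * h m.+1).
  rewrite subrK (exprS r m.+1); move: (r ^+ m.+1) => y; lra.
exists K => // n.
have [nn0|n0n] := leqP n n0.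
  by apply: (le_trans (hS _ (leqW nn0))); apply: (le_trans SK); rewrite ler_peMr.
by have [+ _ _] := main (n - n0)%N; rewrite subnKC // ltnW.
Qed.

Lemma qpochSl (R : realType) (t q : R) n :
  qpoch t q n.+1 = (1 - t) * qpoch (t * q) q n.
Proof.
rewrite /qpoch big_nat_recl //= expr0 mulr1; congr (_ * _).
by apply: eq_bigr => i _; rewrite exprS mulrA.
Qed.

Lemma qhermite_even_growth (R : realType) (q p x : R) :
  `|q| < 1 -> 0 <= p < 1 -> -1 <= x <= 1 ->
  exists K r : R, [/\ 0 <= K, 1 <= r, p * r < 1 &
    forall n, `|qhermite (2 * n) x q| <= K * r ^+ n].
Proof.
move=> hq /andP[p0 p1] hx.
have pp : 0 < 1 + p by lra.
(* Even indices square the rate, and [4p < (1+p)^2] makes [p] times that square less than 1. *)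
have r1 : 1 < 2 / (1 + p) by rewrite ltr_pdivlMr //; lra.
have [K K0 hK] := qhermite_bound hq hx r1.
exists K, ((2 / (1 + p)) ^+ 2); split=> [//||| n].
- by rewrite exprn_ege1 // ltW.
- rewrite expr_div_n mulrA ltr_pdivrMr ?exprn_gt0 //.
  have : 0 < (1 - p) ^+ 2 by rewrite exprn_gt0 // subr_gt0.
  by lra.
- by rewrite -exprM.
Qed.

(** * The functional equation of [G] and its iteration *)

Lemma geometric_bound_cvg0 (R : realType) (a : nat -> R) (C s : R) :
  0 <= s < 1 -> (forall n, `|a n| <= C * s ^+ n) -> a @ \oo --> 0.
Proof.
move=> /andP[s0 s1] ha; apply: norm_cvg0.
apply: (@squeeze_cvgr _ _ _ _ (fun=> 0) (geometric C s)).
- by apply: nearW => n; rewrite normr_ge0 ha.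
- exact: cvg_cst.
- by apply: cvg_geometric; rewrite ger0_norm.
Qed.

(* [\sum_j mehler_coef q t j * h_(2j)] is, up to a factor independent of [x], the
   diagonal Poisson-Mehler kernel [\sum_n h_n(x|q)^2 t^n / (q)_n] after linearizing
   [h_n^2]. *)
Definition mehler_coef (R : realType) (q t : R) (j : nat) : R :=
  t ^+ j / (qpoch q q j * qpoch t q j.+1).

Definition mehler_term (R : realType) (q x t : R) (j : nat) : R :=
  mehler_coef q t j * qhermite (2 * j) x q.

Definition mehler_sum (R : realType) (q x t : R) : R :=
  limn (series (mehler_term q x t)).

Lemma mehler_coef_le (R : realType) (q : R) : `|q| < 1 -> exists2 D : R, 0 <= D &
  forall t n, `|t| <= `|q| -> `|mehler_coef q t n| <= D * `|t| ^+ n.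
Proof.
move=> hq.
have hp : 0 <= `|q| < 1 by rewrite normr_ge0.
have [d /andP[d0 _] hd] := qfact_lower_bound hp.
exists ((d * d)^-1); first by rewrite invr_ge0 mulr_ge0 // ltW.
move=> t n ht; rewrite normrM normrX mulrC ler_wpM2r ?exprn_ge0 //.
rewrite normfV normrM.
have /andP[l1 _] := qpoch_norm_bounds hq (lexx _) d0 hd n.
have /andP[l2 _] := qpoch_norm_bounds hq ht d0 hd n.+1.
rewrite lef_pV2 ?posrE ?mulr_gt0 ?(lt_le_trans d0) //.
by apply: ler_pM => //; rewrite ltW.
Qed.

(** The first bound is a majorant for the series of [G]; the other two handle the boundary terms of
    [tridiagonal_sum]. [C] and [s] are independent of [t], so that [t = q^(n+1)] may vary. *)
Lemma mehler_term_le (R : realType) (q x : R) : `|q| < 1 -> -1 <= x <= 1 ->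
  exists C s : R, [/\ 0 <= C, 0 <= s < 1 & forall t n, `|t| <= `|q| ->
    [/\ `|mehler_term q x t n| <= C * s ^+ n,
        `|mehler_coef q t n * qhermite (2 * n.+1) x q| <= C * s ^+ n
      & `|mehler_coef q t n.+1 * qhermite (2 * n) x q| <= C * s ^+ n]].
Proof.
move=> hq hx.
have hp : 0 <= `|q| < 1 by rewrite normr_ge0.
have [D D0 hD] := mehler_coef_le hq.
have [K [r [K0 r1 pr hK]]] := qhermite_even_growth hq hp hx.
have r0 : 0 <= r by lra.
exists (D * K * r), (`|q| * r); split; first by rewrite !mulr_ge0.
  by rewrite mulr_ge0.
move=> t n ht.
have pn m : `|mehler_coef q t m| <= D * `|q| ^+ m.
  by apply: (le_trans (hD t m ht)); rewrite ler_wpM2l // lerXn2r.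
have DK0 : 0 <= D * K by rewrite mulr_ge0.
have qr0 : 0 <= `|q| ^+ n * r ^+ n by rewrite mulr_ge0 ?exprn_ge0.
rewrite /mehler_term !(normrM (mehler_coef _ _ _)) exprMn; split.
- apply: (le_trans (ler_pM _ _ (pn _) (hK _))) => //.
  have -> : D * `|q| ^+ n * (K * r ^+ n) = D * K * (`|q| ^+ n * r ^+ n) by ring.
  by rewrite ler_wpM2r // ler_peMr.
- apply: (le_trans (ler_pM _ _ (pn _) (hK _))) => //.
  by rewrite exprS le_eqVlt; apply/orP; left; apply/eqP; ring.
- apply: (le_trans (ler_pM _ _ (pn _) (hK _))) => //.
  have -> : D * `|q| ^+ n.+1 * (K * r ^+ n) = D * K * `|q| * (`|q| ^+ n * r ^+ n).
    by rewrite exprS; ring.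
  by rewrite ler_wpM2r // ler_wpM2l // (le_trans _ r1) // ltW.
Qed.

Lemma mehler_cvg (R : realType) (q x t : R) : `|q| < 1 -> -1 <= x <= 1 -> `|t| <= `|q| ->
  cvgn (series (mehler_term q x t)).
Proof.
move=> hq hx ht; have [C [s [C0 /andP[s0 s1] hC]]] := mehler_term_le hq hx.
apply: (@series_dominated_cvg _ _ (geometric C s)).
  by move=> k; have [] := hC t k ht.
by apply: is_cvg_geometric_series; rewrite ger0_norm.
Qed.

(** With [mehler_coef_rec], the functional equation of [G] read on coefficients: the transposed
    matrix of [l(x|t)] turns those at [t] into a multiple of those at [tq]. Index 0 stands apart for
    lack of a lower neighbour. *)
Lemma mehler_coef_rec0 (R : realType) (q t : R) : `|q| < 1 -> `|t| < 1 ->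
  (1 - t ^+ 2) * (1 - t ^+ 2 * q) / (1 - t) ^+ 2 * mehler_coef q (t * q) 0
  = ((1 + t) ^+ 2 - t * (1 - q)) * mehler_coef q t 0
    + - t * (1 - q ^+ 2) * (1 - q) * mehler_coef q t 1.
Proof.
move=> hq ht.
have tn1 : 1 - t != 0 by exact: subr1_neq0.
have tn2 : 1 - t * q != 0.
  by apply: subr1_neq0; rewrite normrM mulr_ilt1.
have q1 : 1 - q != 0 by exact: subr1_neq0.
rewrite /mehler_coef !qfactS !qpochS !qpoch0 !expr0 !expr1 !mulr1 !mul1r.
by field; do ?[apply/andP; split].
Qed.

Lemma mehler_coef_rec (R : realType) (q t : R) : `|q| < 1 -> `|t| < 1 -> forall k,
  (1 - t ^+ 2) * (1 - t ^+ 2 * q) / (1 - t) ^+ 2 * mehler_coef q (t * q) k.+1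
  = ((1 + t) ^+ 2 - t * (2 - q ^+ (2 * k.+1) - q ^+ (2 * k.+1).+1)) * mehler_coef q t k.+1
    + - t * mehler_coef q t k
    + - t * (1 - q ^+ (2 * k.+1).+2) * (1 - q ^+ (2 * k.+1).+1) * mehler_coef q t k.+2.
Proof.
move=> hq ht k.
have tn i : 1 - t * q ^+ i != 0.
  apply: subr1_neq0; rewrite normrM normrX.
  by apply: (le_lt_trans _ ht); rewrite ler_piMr // exprn_ile1 // ltW.
have tn1 : 1 - t != 0 by exact: subr1_neq0.
have nz j : 1 - q ^+ j.+1 != 0 by exact: subr1X_neq0.
have nf j : qpoch q q j != 0 by exact: qfact_neq0.
have nT : qpoch t q k.+1 != 0.
  by rewrite /qpoch big_mkord; apply/prodf_neq0 => i _; exact: tn.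
have eT : qpoch (t * q) q k.+2 = qpoch t q k.+3 / (1 - t).
  by rewrite (qpochSl t) mulrAC divff ?mul1r.
rewrite /mehler_coef eT.
have := tn k.+1; have := tn k.+2; have := nz k; have := nz k.+1; have := nf k.
rewrite (qpochS t q k.+2) (qpochS t q k.+1) (qfactS q k.+1) (qfactS q k).
rewrite exprMn (_ : (2 * k.+1 = (k * 2).+2)%N); last by rewrite mulnC.
rewrite (exprS t k.+1) (exprS t k) !(exprS q) (exprM q k 2).
move: (qpoch _ _ _) nT (qpoch _ _ _) (q ^+ k) (t ^+ k) => T nT Q a b *.
by field; do ?[apply/andP; split].
Qed.

Lemma cvg_series_lim (R : realType) (u : nat -> R) (s : R) :
  series u @ \oo --> s -> limn (series u) = s.
Proof. by move=> /cvg_lim; apply. Qed.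

Lemma mehler_functional (R : realType) (q x t : R) :
  `|q| < 1 -> -1 <= x <= 1 -> `|t| <= `|q| ->
  (1 - t) ^+ 2 * lfac x t * mehler_sum q x t
    = (1 - t ^+ 2) * (1 - t ^+ 2 * q) * mehler_sum q x (t * q).
Proof.
move=> hq hx htq.
have ht : `|t| < 1 by exact: le_lt_trans hq.
have tn : 1 - t != 0 by exact: subr1_neq0.
have htq2 : `|t * q| <= `|q| by rewrite normrM ler_piMl // ltW.
pose kap := (1 - t ^+ 2) * (1 - t ^+ 2 * q) / (1 - t) ^+ 2.
pose u k := qhermite (2 * k) x q.
pose al k := (1 + t) ^+ 2 - t * (if k is 0 then 1 - q else 2 - q ^+ (2 * k) - q ^+ (2 * k).+1).
pose ga k := - t * (1 - q ^+ (2 * k).+2) * (1 - q ^+ (2 * k).+1).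
have u0 : lfac x t * u 0%N = al 0%N * u 0%N + - t * u 1%N.
  by rewrite /u muln0 muln1 /al /lfac /=; ring.
have uS k : lfac x t * u k.+1 = al k.+1 * u k.+1 + - t * u k.+2 + ga k * u k.
  rewrite /u (_ : 2 * k.+2 = (2 * k.+1).+2)%N; last by rewrite mulnS.
  rewrite /al (_ : 2 * k.+1 = (2 * k).+2)%N; last by rewrite mulnS.
  by rewrite /ga /lfac !qhermiteSS !exprS; ring.
have e0 : kap * mehler_coef q (t * q) 0 = al 0%N * mehler_coef q t 0 + ga 0%N * mehler_coef q t 1.
  by rewrite mehler_coef_rec0 // /al /ga muln0 expr1.
have eS k : kap * mehler_coef q (t * q) k.+1 = al k.+1 * mehler_coef q t k.+1
    + - t * mehler_coef q t k + ga k.+1 * mehler_coef q t k.+2.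
  by rewrite mehler_coef_rec.
have sumE := @tridiagonal_sum _ _ _ _ _ _ _ (fun k => kap * mehler_coef q (t * q) k) u0 uS e0 eS.
have cG : series (mehler_term q x t) @ \oo --> mehler_sum q x t by exact: mehler_cvg.
have cGq : series (mehler_term q x (t * q)) @ \oo --> mehler_sum q x (t * q).
  exact: mehler_cvg.
have [C [s [C0 s01 hC]]] := mehler_term_le hq hx.
have cb : (- t * (mehler_coef q t n * u n.+1)) @[n --> \oo] --> (0 : R).
  apply: (@geometric_bound_cvg0 _ _ C s s01) => n.
  have [_ h _] := hC t n htq; rewrite normrM normrN.
  by apply: le_trans h; rewrite ler_piMl // ltW.
have X2 m : `|1 - q ^+ m| <= 2.
  apply: (le_trans (ler_normB _ _)); rewrite normr1 normrX.
  have : `|q| ^+ m <= 1 by rewrite exprn_ile1 // ltW.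
  by lra.
have cg : (ga n * (mehler_coef q t n.+1 * u n)) @[n --> \oo] --> (0 : R).
  apply: (@geometric_bound_cvg0 _ _ (4 * C) s s01) => n.
  have [_ _ h] := hC t n htq; rewrite normrM -mulrA; apply: ler_pM => //.
  rewrite /ga !normrM normrN.
  have -> : 4 = 1 * 2 * 2 :> R by ring.
  by rewrite !ler_pM ?mulr_ge0 // ltW.
(* The same partial sums get two limits, one directly and one through the tridiagonal identity,
   whose boundary terms tend to 0. *)
have lim1 : (lfac x t * series (mehler_term q x t) n.+1) @[n --> \oo]
    --> lfac x t * mehler_sum q x t.
  by apply: cvgM; [exact: cvg_cst|rewrite (cvg_shiftS (series _))].
have lim2 : (lfac x t * series (mehler_term q x t) n.+1) @[n --> \oo]
    --> kap * mehler_sum q x (t * q) + 0 - 0.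
  have -> : (fun n => lfac x t * series (mehler_term q x t) n.+1) =
     (fun n => kap * series (mehler_term q x (t * q)) n.+1
       + - t * (mehler_coef q t n * u n.+1) - ga n * (mehler_coef q t n.+1 * u n)).
    apply/funext => n; rewrite /series /mehler_term /= sumE mulr_sumr -(mulrA (- t)) -(mulrA (ga n)).
    by congr (_ + _ - _); apply: eq_bigr => k _; rewrite -(mulrA kap).
  apply: cvgB cg; apply: cvgD cb.
  by apply: cvgM; [exact: cvg_cst|rewrite (cvg_shiftS (series _))].
have := cvg_unique _ lim1 lim2; rewrite addr0 subr0 => lim12.
by rewrite -mulrA (lim12 _) // /kap; field.
Qed.

(** At [t = q^j] the right-hand factor of the functional equation is [(1 - q^(2j))(1 - q^(2j+1))];
    these multiply up to [(q)_(2n+1) / (1-q)]. *)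
Lemma lprod_mehler (R : realType) (q x : R) : `|q| < 1 -> -1 <= x <= 1 -> forall n,
  (1 - q) * qpoch q q n ^+ 2 * lprod q x n * mehler_sum q x q
    = qpoch q q (2 * n).+1 * mehler_sum q x (q ^+ n.+1).
Proof.
move=> hq hx; elim=> [|n IH].
  by rewrite /lprod big_geq // qfactS !qpoch0 !expr1 !mulr1 mul1r expr1n mulr1.
have tq : `|q ^+ n.+1| <= `|q|.
  by rewrite normrX exprS ler_piMr // exprn_ile1 // ltW.
have F := mehler_functional hq hx tq.
rewrite -exprSr in F.
rewrite lprodS (qfactS q n).
have -> : (1 - q) * (qpoch q q n * (1 - q ^+ n.+1)) ^+ 2 * (lprod q x n * lfac x (q ^+ n.+1)) *
   mehler_sum q x q = (1 - q ^+ n.+1) ^+ 2 * lfac x (q ^+ n.+1) *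
     ((1 - q) * qpoch q q n ^+ 2 * lprod q x n * mehler_sum q x q) by ring.
rewrite IH mulrCA F mulrA; congr (_ * _).
rewrite (_ : 2 * n.+1 = (2 * n).+2)%N; last by rewrite mulnS.
rewrite (qfactS q (2 * n).+2) (qfactS q (2 * n).+1).
rewrite -exprM (_ : n.+1 * 2 = (2 * n).+2)%N; last by rewrite mulnC mulnS.
by rewrite (exprSr q (2 * n).+2) mulrA.
Qed.

(** As [t --> 0] only the term of index 0, equal to [1/(1-t)], survives; the other coefficients are
    [O(t)]. *)
Lemma mehler_sum_cvg1 (R : realType) (q x : R) : `|q| < 1 -> -1 <= x <= 1 ->
  mehler_sum q x (q ^+ n.+1) @[n --> \oo] --> (1 : R).
Proof.
move=> hq hx.
have tq n : `|q ^+ n.+1| <= `|q|.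
  by rewrite normrX exprS ler_piMr // exprn_ile1 // ltW.
have cq : q ^+ n.+1 @[n --> \oo] --> (0 : R).
  by rewrite (cvg_shiftS (fun n => q ^+ n)); exact: cvg_expr.
have [C [s [C0 /andP[s0 s1] hC]]] := mehler_term_le hq hx.
have [D D0 hD] := mehler_coef_le hq.
pose g k : R := if k is 0 then 1 else 0.
have -> : 1 = limn (series g).
  apply/esym/cvg_series_lim; rewrite -(cvg_shiftS (series g)).
  have -> : [sequence series g n.+1]_n = fun=> 1.
    by apply/funext => n; rewrite /series /= big_nat_recl //= big1 ?addr0.
  exact: cvg_cst.
apply: (@tannery _ (fun n => mehler_term q x (q ^+ n.+1)) g (geometric C s)).
- by move=> n k; have [] := hC _ k (tq n).
- by apply: is_cvg_geometric_series; rewrite ger0_norm.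
- case=> [|k].
    rewrite /mehler_term /mehler_coef muln0 /=.
    have -> : (fun n => q ^+ n.+1 ^+ 0 / (qpoch q q 0 * qpoch (q ^+ n.+1) q 1) * 1)
        = (fun n => (1 - q ^+ n.+1)^-1).
      by apply/funext => n; rewrite expr0 qpochS !qpoch0 expr0 !mul1r !mulr1.
    rewrite -[X in _ --> X]invr1; apply: cvgV; first exact: oner_neq0.
    rewrite -[X in _ --> X]subr0; apply: cvgB => //; exact: cvg_cst.
  apply: norm_cvg0.
  pose B := D * `|qhermite (2 * k.+1) x q|.
  apply: (@squeeze_cvgr _ _ _ _ (fun=> 0) (fun n => B * `|q ^+ n.+1|)).
  + apply: nearW => n; rewrite normr_ge0 /= /mehler_term normrM /B mulrAC.
    rewrite ler_wpM2r //; apply: (le_trans (hD _ _ (tq n))).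
    rewrite ler_wpM2l // exprS ler_piMr // exprn_ile1 //.
    by apply: (le_trans (tq n)); exact: ltW.
  + exact: cvg_cst.
  + rewrite -[X in _ --> X](mulr0 B) -(normr0 R); apply: cvgM; first exact: cvg_cst.
    exact: cvg_norm.
- by move=> n; exact: mehler_cvg.
Qed.

(** * Limit of the finite triple product *)

Lemma cvgn_double_succ (R : realType) (u : nat -> R) (l : R) :
  u @ \oo --> l -> u (2 * n).+1 @[n --> \oo] --> l.
Proof.
apply: (@cvg_comp _ _ _ (fun n => (2 * n).+1) u).
apply: (@cvg_comp _ _ _ (muln 2) S _ \oo); last exact: (cvg_addnl 1).
exact: cvg_mulnl.
Qed.

Lemma triple_coef_cvg (R : realType) (q : R) k : `|q| < 1 ->
  triple_coef q n k @[n --> \oo] --> (-1) ^+ k * q ^+ 'C(k + 1, 2) / qpoch_inf q q.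
Proof.
(* The shift by [k] puts every index in the support. All three factorials then tend to [(q)_oo], and
   one cancels. *)
move=> hq; rewrite -(cvg_shiftn k).
have -> : [sequence triple_coef q (n + k)%N k]_n = fun n =>
    (-1) ^+ k * q ^+ 'C(k + 1, 2) *
      (qpoch q q (2 * (n + k)).+1 / (qpoch q q n * qpoch q q (n + 2 * k).+1)).
  apply/funext => n; apply: triple_coefE; first by rewrite addnC.
    by rewrite addn1.
  by rewrite addn1 addnC.
apply: cvgM; first exact: cvg_cst.
have c0 := qpoch_cvg hq; have n0 := qpoch_inf_neq0 hq.
have -> : (qpoch_inf q q)^-1 = qpoch_inf q q / (qpoch_inf q q * qpoch_inf q q).
  by field.
apply: cvgM.
  have := cvgn_double_succ c0; rewrite -(cvg_shiftn k); exact.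
apply: cvgV; first by rewrite mulf_neq0.
apply: cvgM => //.
apply: (@cvg_comp _ _ _ (fun n => (n + 2 * k).+1) (qpoch q q) _ \oo) c0.
have -> : (fun n => (n + 2 * k).+1) = (fun n => n + (2 * k).+1)%N.
  by apply/funext => n; rewrite addnS.
exact: cvg_addnr.
Qed.

Lemma lprod_cvg (R : realType) (q x : R) : `|q| < 1 -> -1 <= x <= 1 ->
  let a j := (-1) ^+ j * q ^+ 'C(j + 1, 2) * chebyU (2 * j) x in
  exists2 S : R, series a @ \oo --> qpoch_inf q q * S & lprod q x @ \oo --> S.
Proof.
move=> hq hx a.
have hp : 0 <= `|q| < 1 by rewrite normr_ge0.
have n0 := qpoch_inf_neq0 hq.
have h0 : `|0 : R| < 1 by rewrite normr0.
(* Applied with base 0 in place of [q], this bounds [U_(2j)], at a rate still beaten by [|q|]. *)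
have [K [r [K0 r1 pr hK]]] := qhermite_even_growth h0 hp hx.
have r0 : 0 <= r by lra.
have s01 : 0 <= `|q| * r by rewrite mulr_ge0.
have [d /andP[d0 d1] hd] := qfact_lower_bound hp.
have bd n := qpoch_norm_bounds hq (lexx _) d0 hd n.
(* A bound for all [q]-binomials: the numerator is at most [d^-1], each denominator factor at least
   [d]. The power of [q] supplies [|q|^k]. *)
pose W := d^-1 / (d * d).
have W0 : 0 <= W by rewrite mulr_ge0 ?invr_ge0 ?mulr_ge0 // ltW.
have cle n k : `|triple_coef q n k| <= W * `|q| ^+ k.
  rewrite /triple_coef !normrM !normrX normrN1 expr1n mul1r mulrC.
  apply: ler_pM; rewrite ?exprn_ge0 //; last first.
    by rewrite addn1 binS bin1 exprD ler_piMl ?exprn_ge0 // exprn_ile1 // ltW.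
  case: ifP => // kn; last by rewrite normr0.
  rewrite /qbinom; case: ifP => _; last by rewrite normr0.
  rewrite normrM normfV normrM; apply: ler_pM => //.
    by case/andP: (bd (2 * n + 1)%N).
  have /andP[l1 _] := bd (n - k)%N; have /andP[l2 _] := bd (2 * n + 1 - (n - k))%N.
  rewrite lef_pV2 ?posrE ?mulr_gt0 ?(lt_le_trans d0) //.
  by apply: ler_pM => //; exact: ltW.
pose g k := a k / qpoch_inf q q.
pose M := geometric (W * K) (`|q| * r).
have cM : cvgn (series M) by apply: is_cvg_geometric_series; rewrite ger0_norm.
pose f n k := triple_coef q n k * chebyU (2 * k) x.
have fM n k : `|f n k| <= M k.
  rewrite /f normrM /M /geometric /= exprMn.
  have uK : `|chebyU (2 * k) x| <= K * r ^+ k by rewrite -qhermite_q0.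
  apply: (le_trans (ler_pM _ _ (cle n k) uK)) => //.
  by rewrite le_eqVlt; apply/orP; left; apply/eqP; ring.
have fg k : f n k @[n --> \oo] --> g k.
  have -> : g k = (-1) ^+ k * q ^+ 'C(k + 1, 2) / qpoch_inf q q * chebyU (2 * k) x.
    by rewrite /g /a; ring.
  by apply: cvgM; [exact: triple_coef_cvg|exact: cvg_cst].
have fs n : series (f n) @ \oo --> lprod q x n.
  rewrite -(cvg_shiftn n.+1).
  have -> : [sequence series (f n) (m + n.+1)%N]_m = fun=> lprod q x n.
    apply/funext => m; rewrite lprod_chebyU // /series /= (big_cat_nat (n := n.+1)) ?leq_addl //=.
    rewrite [X in _ + X]big_nat_cond [X in _ + X]big1 ?addr0 // => k /andP[/andP[nk _] _].
    by rewrite /f triple_coef_gt // mul0r.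
  exact: cvg_cst.
have gM k : `|g k| <= M k.
  by apply: (cvgr_to_le (cvg_norm (fg k))); exact: nearW.
exists (limn (series g)); last exact: tannery fM cM fg fs.
have cg : cvgn (series g) by exact: series_dominated_cvg cM.
have -> : series a = (fun n => qpoch_inf q q * series g n).
  apply/funext => n; rewrite /series /= mulr_sumr; apply: eq_bigr => k _.
  by rewrite /g mulrC divfK.
by apply: cvgM => //; exact: cvg_cst.
Qed.

(** * Assembly of (i) and the two expansions of (ii) *)

Theorem theorem3 (R : realType) (q : R) (hq : `|q| < 1) :
  (forall m : nat, (1 <= m)%N ->
     \sum_(0 <= j < m.+1)
        (-1) ^+ j * q ^+ 'C(j, 2) * qbinom q m (m - j)
          * qbinom q (2 * m - j) m * (1 / (1 - q ^+ (m - j + 1))) = 0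
     /\
     \sum_(0 <= k < m.+1)
        (-1) ^+ k * q ^+ 'C(k, 2) * qbinom q (2 * m) (m - k)
          * ((1 - q ^+ (2 * k + 1)) / (1 - q ^+ (m + k + 1))) = 0)
  /\
  (forall x : R, -1 <= x <= 1 ->
     [/\ cvgn (qpoch q q),
         cvgn (lprod q x),
         qpoch_inf q q * lprod_inf q x != 0,
         series (fun j : nat =>
             (-1) ^+ j * q ^+ 'C(j + 1, 2) * chebyU (2 * j) x) @ \oo
           --> qpoch_inf q q * lprod_inf q x
       & series (fun j : nat =>
             (1 - q) * q ^+ j / (qpoch q q j ^+ 2 * (1 - q ^+ (j + 1)))
               * qhermite (2 * j) x q) @ \oo
           --> 1 / (qpoch_inf q q * lprod_inf q x)]).
Proof.
split=> [m m1|x hx]; first by split; [exact: first_sum_eq0|exact: second_sum_eq0].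
have cq := qpoch_cvg hq; have n0 := qpoch_inf_neq0 hq.
have [S cS cL] := lprod_cvg hq hx.
have LE : lprod_inf q x = S by exact: (cvg_lim _ cL).
rewrite LE.
(* The limit [n --> oo] of [lprod_mehler]. *)
have key : (1 - q) * qpoch_inf q q ^+ 2 * S * mehler_sum q x q = qpoch_inf q q.
  have l1 : ((1 - q) * (qpoch q q n * qpoch q q n) * lprod q x n * mehler_sum q x q) @[n --> \oo]
      --> (1 - q) * (qpoch_inf q q * qpoch_inf q q) * S * mehler_sum q x q.
    apply: cvgM; last exact: cvg_cst.
    by apply: cvgM => //; apply: cvgM; [exact: cvg_cst|exact: cvgM].
  have l2 : (qpoch q q (2 * n).+1 * mehler_sum q x (q ^+ n.+1)) @[n --> \oo]
      --> qpoch_inf q q * 1.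
    apply: cvgM; last exact: mehler_sum_cvg1.
    exact: (cvgn_double_succ cq).
  rewrite (_ : (fun n => _) = fun n => qpoch q q (2 * n).+1 * mehler_sum q x (q ^+ n.+1)) in l1.
    by rewrite expr2 -[RHS]mulr1; apply: (cvg_unique _ l1 l2).
  by apply/funext => n; rewrite -expr2 lprod_mehler.
have inv : qpoch_inf q q * S * ((1 - q) * mehler_sum q x q) = 1.
  by apply: (mulfI n0); rewrite mulr1 -[RHS]key; ring.
(* Nonvanishing of the infinite product is read off from its explicit inverse. *)
have SN : qpoch_inf q q * S != 0.
  by apply/eqP => S0; move: inv; rewrite S0 mul0r => /esym/eqP; rewrite oner_eq0.
split=> //; first by apply/cvg_ex; exists S.
have -> : 1 / (qpoch_inf q q * S) = (1 - q) * mehler_sum q x q.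
  by rewrite -[X in X / _]inv mulrAC divff // mul1r.
(* At [t = q] the factor [(t)_(j+1)] is [(q)_j (1 - q^(j+1))], which yields the square. *)
have -> : series (fun j : nat => (1 - q) * q ^+ j /
    (qpoch q q j ^+ 2 * (1 - q ^+ (j + 1))) * qhermite (2 * j) x q)
   = (fun n => (1 - q) * series (mehler_term q x q) n).
  apply/funext => n; rewrite /series /= mulr_sumr; apply: eq_bigr => j _.
  by rewrite /mehler_term /mehler_coef qfactS addn1 expr2 !mulrA.
by apply: cvgM; [exact: cvg_cst|apply: mehler_cvg].
Qed.
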